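(* Let $n\geq 0$ be an integer. If $n<\max\{t_1,t_2,t_3\}$ or $n+1\geq t_1+t_2+t_3$, then $\dim_{\mathbb C}\mathscr M_n=2(n+1)$.
   Context: Fix real numbers $k_1,k_2,k_3$. For $i=1,2,3$ let $R_i$ be the operator on functions on $\mathbb R^3$ replacing $x_i$ by $-x_i$, and let $T_i$ be the Dunkl operator $T_if=\frac{\partial f}{\partial x_i}+k_i\frac{f-R_if}{x_i}$. Let $\sigma_1=\begin{pmatrix}0&1\\1&0\end{pmatrix}$, $\sigma_2=\begin{pmatrix}0&-\sqrt{-1}\\ \sqrt{-1}&0\end{pmatrix}$, $\sigma_3=\begin{pmatrix}1&0\\0&-1\end{pmatrix}$, and let $e_i$ act on $\mathbb C^2$ by $\sigma_i$ (a representation of the Clifford algebra of $\mathbb R^3$). Tensor products are over $\mathbb R$; $\mathbb R[x_1,x_2,x_3]_n$ denotes the homogeneous polynomials of degree $n$. The Dirac–Dunkl operator is $\mathbf D=e_1\otimes T_1+e_2\otimes T_2+e_3\otimes T_3$ acting on $\mathbb C^2\otimes\mathbb R[x_1,x_2,x_3]$, and $\mathscr M_n=\ker\big(\mathbf D|_{\mathbb C^2\otimes\mathbb R[x_1,x_2,x_3]_n}\big)$, a complex vector space. For $i=1,2,3$ set $t_i=-2k_i$ if $2k_i$ is an odd negative integer, and $t_i=\infty$ otherwise (with the usual conventions for sums and comparisons involving $\infty$). *)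

(* Defs.v *)
From HB Require Import structures.
From mathcomp Require Import all_boot all_algebra.
From mathcomp Require Import mpoly.
From mathcomp Require Import complex.
From Stdlib Require Import Rdefinitions.
From mathcomp Require Import Rstruct.

Set Implicit Arguments.
Unset Strict Implicit.
Unset Printing Implicit Defensive.

Import GRing.Theory.
Local Open Scope ring_scope.

Notation CC := (complex R).
(* polynomials in x_1,x_2,x_3 with complex coefficients
   (C (x) R[x_1,x_2,x_3] viewed as C[x_1,x_2,x_3]); index i : 'I_3 is x_(i+1) *)
Notation Pol := {mpoly CC[3]}.

Definition RtoC (a : R) : CC := Complex a 0.

Definition reflect_var (i : 'I_3) (f : Pol) : Pol :=
  f \mPo [tuple (if j == i then - 'X_j else 'X_j) | j < 3].

(* division by x_i (of a polynomial divisible by x_i): lowers the exponent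
   of x_i in every monomial by one *)
Definition divX (i : 'I_3) (h : Pol) : Pol :=
  \sum_(m <- msupp h) h@_m *: 'X_[m - U_(i)%MM].

Definition dunkl (k : 'I_3 -> R) (i : 'I_3) (f : Pol) : Pol :=
  mderiv i f + RtoC (k i) *: divX i (f - reflect_var i f).

(* Pauli matrices sigma_1, sigma_2, sigma_3 (index i : 'I_3 is sigma_(i+1)) *)
Definition sigma (i : 'I_3) : 'M[CC]_2 :=
  if i == 0 :> nat then \matrix_(a < 2, b < 2) (if a == b then 0 else 1)
  else if i == 1 :> nat then
    \matrix_(a < 2, b < 2)
      (if a == b then 0 else if a == 0 :> nat then - Complex 0 1 else Complex 0 1)
  else \matrix_(a < 2, b < 2)
      (if a == b then (if a == 0 :> nat then 1 else -1) else 0).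

(* C^2 (x) R[x_1,x_2,x_3] = column vectors of length 2 with entries in Pol *)
Notation Spinor := 'cV[Pol]_2.

(* Dirac-Dunkl operator D = sum_i e_i (x) T_i, e_i acting by sigma_i *)
Definition dirac_dunkl (k : 'I_3 -> R) (v : Spinor) : Spinor :=
  \sum_(i < 3) map_mx (fun c : CC => c%:MP) (sigma i) *m map_mx (dunkl k i) v.

Definition monogenic (k : 'I_3 -> R) (n : nat) (v : Spinor) : Prop :=
  (forall a b, v a b \is n.-homog) /\ dirac_dunkl k v = 0.

Definition cscale (c : CC) (v : Spinor) : Spinor := c%:MP *: v.

Definition has_dimC (S : Spinor -> Prop) (d : nat) : Prop :=
  exists b : 'I_d -> Spinor,
    (forall j, S (b j)) /\
    (forall c : 'I_d -> CC, \sum_j cscale (c j) (b j) = 0 -> forall j, c j = 0) /\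
    (forall v, S v -> exists c : 'I_d -> CC, v = \sum_j cscale (c j) (b j)).

(* t_i = m  (m a natural number) iff 2 k_i is the odd negative integer -m;
   if no such m exists, t_i = infinity *)
Definition t_is (ki : R) (m : nat) : Prop := odd m /\ 2 * ki = - (m%:R).

(* n < t_i  (true when t_i = infinity) *)
Definition lt_t (n : nat) (ki : R) : Prop := forall m, t_is ki m -> ltn n m.

Definition lt_max_t (n : nat) (k : 'I_3 -> R) : Prop := exists i, lt_t n (k i).

(* n + 1 >= t_1 + t_2 + t_3  (false as soon as some t_i = infinity) *)
Definition sum_t_le (n : nat) (k : 'I_3 -> R) : Prop :=
  exists m : 'I_3 -> nat, (forall i, t_is (k i) (m i)) /\ leq (\sum_i m i)%N n.+1.

(* Main.v *)
(** On monomials T_i x^m = [m_i] x^(m - e_i), where [p] = p for p even and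
    [p] = p + 2 k_i for p odd; for p > 0, [p] = 0 exactly when p = t_i.
    It suffices that D maps degree n + 1 onto degree n: the dimension is then
    (n + 3)(n + 2) - (n + 2)(n + 1) = 2(n + 2) by rank-nullity, while D = 0 in
    degree 0.
    To reach u x^m with |m| = n, pick i such that [p] <> 0 for m_i < p <= n + 1.
    As sigma_i^2 = 1, the spinor sigma_i u x^(m + e_i) / [m_i + 1] is a preimage
    up to monomials of strictly larger degree in x_i, for which the same i
    works, so induction on n - m_i concludes.  Such an i exists: if n + 1 < t_i
    for some i, take it; if t_1 + t_2 + t_3 <= n + 2, then m_i >= t_i for some i,
    since otherwise n = |m| <= t_1 + t_2 + t_3 - 3. *)

Require Import Defs.
From HB Require Import structures.
From mathcomp Require Import all_boot all_algebra.
From mathcomp Require Import bigenough ssrcomplements mpoly complex.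
From Stdlib Require Import Rdefinitions.
From mathcomp Require Import Rstruct.
From mathcomp Require Import zify ring.

Import GRing.Theory Num.Theory BigEnough.

(* Loading [Rdefinitions] rebinds these keys to [N_scope] and [R_scope]. *)
Delimit Scope nat_scope with N.
Delimit Scope ring_scope with R.
Local Open Scope ring_scope.

(** * Dunkl operators: linearity and action on monomials *)

(** An index set independent of the support of [h] lets several polynomials share one sum, so that
    linearity can be checked term by term. *)
Lemma divXwE i (h : Pol) w : (msize h <= w)%N ->
  divX i h = \sum_(m : 'X_{1..3 < w}) h@_m *: 'X_[m - U_(i)].
Proof.
move=> lt_hw; rewrite /divX (big_mksub 'X_{1..3 < w}) /=.
- by rewrite big_rmcond //= => j /memN_msupp_eq0 ->; rewrite scale0r.
- exact: msupp_uniq.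
- by move=> m /msize_mdeg_lt/leq_trans/(_ lt_hw).
Qed.

Lemma divX_is_linear i : linear (divX i).
Proof.
move=> c p q; pose_big_enough w; first rewrite !(@divXwE i _ w) //.
  rewrite scaler_sumr -big_split /=; apply: eq_bigr => m _.
  by rewrite mcoeffD mcoeffZ scalerDl scalerA.
by close.
Qed.

HB.instance Definition _ i :=
  GRing.isLinear.Build CC Pol Pol _ (divX i) (divX_is_linear i).

Lemma divXX i m : divX i 'X_[m] = 'X_[m - U_(i)].
Proof. by rewrite /divX msuppX big_seq1 mcoeffX eqxx scale1r. Qed.

Lemma dunkl_is_linear k i : linear (dunkl k i).
Proof.
move=> c p q; rewrite /dunkl /reflect_var comp_mpolyD comp_mpolyZ.
rewrite opprD addrACA -scalerBr !linearP /= !scalerDr !scalerA [c * _]mulrC.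
by rewrite addrACA.
Qed.

HB.instance Definition _ k i :=
  GRing.isLinear.Build CC Pol Pol _ (dunkl k i) (dunkl_is_linear k i).

Lemma reflect_varX i m : reflect_var i 'X_[m] = (-1) ^+ (m i) *: 'X_[m].
Proof.
rewrite /reflect_var comp_mpolyX [in RHS](mpolyXE_id CC m).
rewrite (bigD1 i) //= [in RHS](bigD1 i) //= tnth_mktuple eqxx.
rewrite -mul_mpolyC [RHS]mulrA; congr (_ * _).
  by rewrite [LHS]exprNn rmorphXn rmorphN1.
by apply: eq_bigr => j ji; rewrite tnth_mktuple (negbTE ji).
Qed.

(** The number [p] by which a Dunkl operator with parameter [a] multiplies when it lowers an
    exponent [p]. *)
Definition dunkl_num (a : R) (p : nat) : R :=
  (p%:R + (if odd p then 2 * a else 0))%R.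

Lemma RtoCE a : RtoC a = real_complex R a. Proof. by []. Qed.

Lemma RtoC_dunkl_num0 a : RtoC (dunkl_num a 0) = 0.
Proof. by rewrite /dunkl_num /= addr0. Qed.

(* For m i = 0 the junk value m - U_(i) = m is harmless: the coefficient is 0. *)
Lemma dunklX k i m :
  dunkl k i 'X_[m] = RtoC (dunkl_num (k i) (m i)) *: 'X_[m - U_(i)].
Proof.
rewrite /dunkl reflect_varX mderivX -signr_odd -[X in X - _]scale1r -scalerBl.
rewrite linearZ /= divXX scalerA -scalerDl /dunkl_num !RtoCE rmorphD rmorph_nat.
congr ((_ + _) *: _); case: odd; rewrite ?expr0 ?expr1 ?subrr ?mulr0 ?rmorph0 //.
by rewrite opprK rmorphM rmorph_nat mulrC.
Qed.

Lemma dunkl_num_eq0 a p : (0 < p)%N -> dunkl_num a p = 0 -> t_is a p.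
Proof.
rewrite /dunkl_num /t_is; case: ifP => _ p_gt0 /eqP.
  by rewrite addrC addr_eq0 => /eqP.
by rewrite addr0 pnatr_eq0 -leqn0 leqNgt p_gt0.
Qed.

Lemma t_is_inj a p q : t_is a p -> t_is a q -> p = q.
Proof.
by move=> [_ Ep] [_]; rewrite Ep => /oppr_inj/eqP; rewrite eqr_nat => /eqP.
Qed.

(** * The Dirac-Dunkl operator on spinors *)

Lemma sigma_sqr i : sigma i *m sigma i = 1%:M.
Proof.
apply/matrixP => a b; rewrite !mxE big_ord_recl big_ord1 /sigma.
case: i => [[|[|[|//]]] ?] /=; case: a => [[|[|//]] ?]; case: b => [[|[|//]] ?].
all: rewrite !mxE /=; apply/eqP; rewrite eq_complex /=.
all: apply/andP; split; apply/eqP; ring.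
Qed.

Lemma dirac_dunklE k v a b :
  dirac_dunkl k v a b = \sum_(j < 3) \sum_c sigma j a c *: dunkl k j (v c b).
Proof.
rewrite /dirac_dunkl summxE; apply: eq_bigr => j _; rewrite !mxE.
by apply: eq_bigr => c _; rewrite !mxE mul_mpolyC.
Qed.

Lemma cscaleE c v a b : cscale c v a b = c *: v a b.
Proof. by rewrite mxE mul_mpolyC. Qed.

Lemma dirac_dunkl_cscaleD k c u v :
  dirac_dunkl k (cscale c u + v) = cscale c (dirac_dunkl k u) + dirac_dunkl k v.
Proof.
apply/matrixP => a b; rewrite [RHS]mxE cscaleE.
have E := congr2 (fun x y => c *: x + y)
  (dirac_dunklE k u a b) (dirac_dunklE k v a b).
apply: (etrans (dirac_dunklE k _ a b)); apply: (etrans _ (esym E)).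
rewrite scaler_sumr -big_split /=; apply: eq_bigr => j _.
rewrite scaler_sumr -big_split /=; apply: eq_bigr => d _.
have -> : (cscale c u + v) d b = c *: u d b + v d b by rewrite mxE cscaleE.
rewrite (dunkl_is_linear k j c).
by rewrite scalerDr !scalerA [c * _]mulrC.
Qed.

Definition mono_spinor (m : 'X_{1..3}) (u : 'cV[CC]_2) : Spinor :=
  \col_a (u a 0 *: 'X_[m]).

Lemma dirac_dunkl_mono k m u :
  dirac_dunkl k (mono_spinor m u) =
  \sum_(j < 3) mono_spinor (m - U_(j)) (RtoC (dunkl_num (k j) (m j)) *: (sigma j *m u)).
Proof.
apply/matrixP => a b; rewrite dirac_dunklE summxE; apply: eq_bigr => j _.
rewrite !mxE mulr_sumr scaler_suml; apply: eq_bigr => c _.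
by rewrite mxE linearZ /= dunklX !scalerA; congr (_ *: _); ring.
Qed.

Lemma cscaleN1 v : cscale (-1) v = - v.
Proof. by rewrite /cscale mpolyCN mpolyC1 scaleN1r. Qed.

Lemma dirac_dunkl0 k : dirac_dunkl k 0 = 0.
Proof.
have := dirac_dunkl_cscaleD k (-1) 0 0.
by rewrite !cscaleN1 oppr0 addr0 addNr.
Qed.

(** * Surjectivity onto each homogeneous component *)

(** The index [n] is the degree of the preimage, not that of [w]. *)
Definition dirac_image k n (w : Spinor) :=
  exists2 v : Spinor, (forall a b, v a b \is n.-homog) & dirac_dunkl k v = w.

Lemma dirac_image0 k n : dirac_image k n 0.
Proof.
by exists 0; [move=> a b; rewrite mxE dhomog0 | exact: dirac_dunkl0].
Qed.

Lemma dirac_image_cscaleD k n c w1 w2 :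
  dirac_image k n w1 -> dirac_image k n w2 -> dirac_image k n (cscale c w1 + w2).
Proof.
move=> [v1 h1 <-] [v2 h2 <-]; exists (cscale c v1 + v2).
  move=> a b; rewrite mxE cscaleE; apply: dhomogD; last exact: h2.
  exact/dhomogZ/h1.
exact: dirac_dunkl_cscaleD.
Qed.

Lemma dirac_imageD k n w1 w2 :
  dirac_image k n w1 -> dirac_image k n w2 -> dirac_image k n (w1 + w2).
Proof.
move=> h1 h2; have := dirac_image_cscaleD k n 1 w1 w2 h1 h2.
by rewrite /cscale mpolyC1 scale1r.
Qed.

Lemma dirac_image_sum k n I (r : seq I) (P : pred I) F :
  (forall i, P i -> dirac_image k n (F i)) -> dirac_image k n (\sum_(i <- r | P i) F i).
Proof.
by move=> h; elim/big_ind: _ => //; [exact: dirac_image0 | exact: dirac_imageD].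
Qed.

Lemma mono_spinor0 m : mono_spinor m 0 = 0.
Proof. by apply/matrixP => a b; rewrite !mxE scale0r. Qed.

Lemma dirac_image_mono k n i m u :
  mdeg m = n ->
  (forall p, (m i < p)%N -> (p <= n.+1)%N -> dunkl_num (k i) p != 0) ->
  dirac_image k n.+1 (mono_spinor m u).
Proof.
have [d] := ubnP (n - m i)%N; elim: d m u => // d IHd m u lt_d deg_m nz.
have le_mi : (m i <= n)%N by rewrite -deg_m mdegE (bigD1 i) //= leq_addr.
have nz_i := nz (m i).+1 (leqnn _) le_mi.
pose c := RtoC (dunkl_num (k i) (m i).+1).
have nz_c : c != 0 by rewrite /c RtoCE fmorph_eq0.
pose v := mono_spinor (m + U_(i)) (c^-1 *: (sigma i *m u)).
have hv : forall a b, v a b \is n.+1.-homog.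
  by move=> a b; rewrite mxE rpredZ // dhomogX /= mdegD mdeg1 addn1 deg_m.
have Ev := dirac_dunkl_mono k (m + U_(i)) (c^-1 *: (sigma i *m u)).
rewrite (bigD1 i) //= in Ev.
have Ei : mono_spinor (m + U_(i) - U_(i)) (RtoC (dunkl_num (k i) ((m + U_(i))%MM i)) *:
     (sigma i *m (c^-1 *: (sigma i *m u)))) = mono_spinor m u.
  rewrite addmK mnmDE mnm1E eqxx addn1 -scalemxAr mulmxA sigma_sqr mul1mx.
  by rewrite scalerA divff // scale1r.
rewrite Ei in Ev.
(* The target is D v minus an error term; the error consists of the summands j <> i of D v, which
   the induction handles. *)
have -> : mono_spinor m u =
    cscale (-1) (dirac_dunkl k v - mono_spinor m u) + dirac_dunkl k v.
  by rewrite cscaleN1 opprB addrNK.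
apply: dirac_image_cscaleD; last by exists v.
rewrite Ev [mono_spinor m u + _]addrC addrK; apply: dirac_image_sum => j ji.
have Ej : ((m + U_(i)) j = m j)%MM by rewrite mnmDE mnm1E eq_sym (negbTE ji) addn0.
(* If m_j = 0, the truncated exponent m + e_i - e_j has the wrong degree, but its coefficient [0]
   vanishes. *)
rewrite Ej; have [mj0|mj0] := posnP (m j).
  rewrite mj0 RtoC_dunkl_num0 scale0r mono_spinor0; exact: dirac_image0.
have Ei' : ((m + U_(i) - U_(j)) i = (m i).+1)%MM.
  by rewrite mnmBE mnmDE !mnm1E eqxx (negbTE ji) subn0 addn1.
have le_j : (U_(j) <= m + U_(i))%MM.
  by apply/mnm_lepP => l; rewrite mnm1E; case: eqP => // <-; rewrite Ej.
apply: IHd.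
(* Since m_j > 0 for some j <> i, m_i < n, so n - m_i strictly decreases. *)
- rewrite Ei'; have : (m i < n)%N; last by lia.
  by rewrite -deg_m mdegE (bigD1 i) //= (bigD1 j) //=; lia.
- by have := congr1 mdeg (submK le_j); rewrite !mdegD !mdeg1 deg_m; lia.
(* Raising m_i only shrinks the range of [p] in which [p] must be nonzero. *)
- by move=> p; rewrite Ei' => lt_p; apply: nz; lia.
Qed.

Lemma ex_mono_dir k n m :
  lt_max_t n.+1 k \/ sum_t_le n.+1 k -> mdeg m = n ->
  exists i, forall p, (m i < p)%N -> (p <= n.+1)%N -> dunkl_num (k i) p != 0.
Proof.
case=> [[i lt_i]|[t [ht le_t]]] deg_m.
  exists i => p mp pn; apply/eqP => /(dunkl_num_eq0 _ _ (leq_ltn_trans (leq0n _) mp)).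
  by move/lt_i; rewrite /= ltnNge pn.
have [i le_i] : exists i, (t i <= m i)%N.
  case: (boolP [exists i, (t i <= m i)%N]) => [/existsP //|].
  rewrite negb_exists => /forallP h; exfalso.
  have /leq_trans/(_ (le_t : \sum_j t j <= n.+2)%N) : (\sum_j (m j).+1 <= \sum_j t j)%N.
    by apply: leq_sum => j _; rewrite ltnNge.
  under eq_bigr do rewrite -addn1.
  by rewrite big_split -mdegE deg_m sum1_card card_ord /= addn3 ltnn.
exists i => p mp _; apply/eqP => /(dunkl_num_eq0 _ _ (leq_ltn_trans (leq0n _) mp)).
(* A zero of [p] can only occur at p = t_i, whereas t_i <= m_i < p. *)
by move=> /(t_is_inj _ _ _ (ht i)) tp; move: mp; rewrite -tp ltnNge le_i.
Qed.

Lemma dirac_image_homog k n (w : Spinor) :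
  lt_max_t n.+1 k \/ sum_t_le n.+1 k ->
  (forall a b, w a b \is n.-homog) -> dirac_image k n.+1 w.
Proof.
move=> hk hw.
(* A common size bound, so that both components expand over the same monomials. *)
pose N := (\max_a msize (w a ord0))%N.
have -> : w = \sum_(m : 'X_{1..3 < N}) mono_spinor m (\col_a (w a 0)@_m).
  apply/matrixP => a b; rewrite summxE ord1 {1}[w a 0](@mpolywE _ _ N).
    by apply: eq_bigr => m _; rewrite !mxE.
  exact: (leq_bigmax (F := fun a => msize (w a ord0))).
apply: dirac_image_sum => m _.
have [deg_m|deg_m] := eqVneq (mdeg m) n.
  by have [i nz] := ex_mono_dir k n m hk deg_m; apply: dirac_image_mono deg_m nz.
rewrite [\col_a _](_ : _ = 0) ?mono_spinor0; first exact: dirac_image0.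
by apply/matrixP => a b; rewrite !mxE (dhomog_nemf_coeff (hw a 0)).
Qed.

(** * The operator as a linear map between finite-dimensional spaces *)

(** Monomials free of x_j are killed by T_j, the others lose one degree. For n = 0 the image is 0,
    hence homogeneous of degree [0.-1 = 0] as well. *)
Lemma dirac_dunkl_homog k n (v : Spinor) :
  (forall a b, v a b \is n.-homog) ->
  forall a b, dirac_dunkl k v a b \is n.-1.-homog.
Proof.
move=> hv a b; rewrite dirac_dunklE.
apply: rpred_sum => j _; apply: rpred_sum => c _; apply: dhomogZ.
have := hv c b; set p := v c b => hp.
rewrite [p]mpolyE linear_sum big_seq; apply: rpred_sum => m m_in.
rewrite linearZ; apply: dhomogZ => /=; rewrite dunklX.
have [mj0|mj0] := posnP (m j).
  by rewrite mj0 RtoC_dunkl_num0 scale0r dhomog0.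
have le_j : (U_(j) <= m)%MM by apply/mnm_lepP => l; rewrite mnm1E; case: eqP => // <-.
apply: dhomogZ; rewrite dhomogX /=.
have := congr1 mdeg (submK le_j); rewrite mdegD mdeg1 (dhomog_mf hp m_in) => <-.
by rewrite addn1.
Qed.

(* A vectType rather than the bare function type: canonical structures are then
   found through this constant, which keeps unification fast. *)
Definition hspinor n : vectType CC := {ffun 'I_2 -> dhomog 3 CC n}.

Definition spinor_of n (u : hspinor n) : Spinor :=
  \col_a ((u : {ffun 'I_2 -> dhomog 3 CC n}) a : Pol).

Lemma spinor_ofZD n c (u v : hspinor n) :
  spinor_of n (c *: u + v) = cscale c (spinor_of n u) + spinor_of n v.
Proof. by apply/matrixP => a b; rewrite [RHS]mxE cscaleE !mxE !ffunE. Qed.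

Lemma spinor_of0 n : spinor_of n 0 = 0.
Proof. by apply/matrixP => a b; rewrite !mxE ffunE. Qed.

Lemma spinor_of_homog n (u : hspinor n) a b : spinor_of n u a b \is n.-homog.
Proof. by rewrite mxE; case: (u a). Qed.

Lemma spinor_of_inj n : injective (spinor_of n).
Proof.
move=> u v /matrixP uv; apply/ffunP => a; apply/val_inj.
by have := uv a 0; rewrite !mxE.
Qed.

(** Meaningful only when the components are homogeneous of degree [n]; otherwise [indhomog] yields a
    default value. *)
Definition hspinor_of n (v : Spinor) : hspinor n := [ffun a => indhomog n (v a 0)].

Lemma hspinor_ofK n (v : Spinor) :
  (forall a b, v a b \is n.-homog) -> spinor_of n (hspinor_of n v) = v.
Proof.
move=> hv; apply/matrixP => a b; rewrite mxE ffunE ord1.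
exact: (insubdK _ (hv a 0)).
Qed.

Definition hdirac k n (u : hspinor n) : hspinor n.-1 :=
  hspinor_of n.-1 (dirac_dunkl k (spinor_of n u)).

Lemma hdiracE k n u : spinor_of n.-1 (hdirac k n u) = dirac_dunkl k (spinor_of n u).
Proof. exact/hspinor_ofK/dirac_dunkl_homog/spinor_of_homog. Qed.

Lemma hdirac_is_linear k n : linear (hdirac k n).
Proof.
move=> c u v; apply: spinor_of_inj.
apply: etrans (hdiracE k n _) _; apply: etrans _ (esym (spinor_ofZD _ c _ _)).
apply: etrans (congr1 _ (spinor_ofZD n c u v)) _.
apply: etrans (dirac_dunkl_cscaleD k c _ _) _.
have E := congr2 (fun x y : Spinor => cscale c x + y) (hdiracE k n u) (hdiracE k n v).
exact (esym E).
Qed.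

HB.instance Definition _ k n :=
  GRing.isLinear.Build CC (hspinor n) (hspinor n.-1) _ (hdirac k n)
    (hdirac_is_linear k n).

Lemma spinor_of_sum n I (r : seq I) (c : I -> CC) (F : I -> hspinor n) :
  spinor_of n (\sum_(i <- r) c i *: F i) = \sum_(i <- r) cscale (c i) (spinor_of n (F i)).
Proof.
elim: r => [|i r IHr]; last by rewrite !big_cons spinor_ofZD IHr.
by rewrite !big_nil; apply/matrixP => a b; rewrite !mxE ffunE.
Qed.

(** A basis of the kernel is carried over by [spinor_of]: injectivity gives independence, and
    [hspinor_ofK] gives spanning. *)
Lemma monogenic_dim k n d :
  \dim (lker (linfun (hdirac k n))) = d -> has_dimC (monogenic k n) d.
Proof.
move=> <-; set K := lker _.
have KP u : (u \in K) = (dirac_dunkl k (spinor_of n u) == 0).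
  rewrite memv_ker (lfunE (hdirac k n)); apply/eqP/eqP => E.
    have E1 := congr1 (spinor_of n.-1) E.
    exact (etrans (esym (hdiracE k n u)) (etrans E1 (spinor_of0 _))).
  apply: spinor_of_inj.
  exact (etrans (hdiracE k n u) (etrans E (esym (spinor_of0 _)))).
exists (fun j => spinor_of n (vbasis K)`_j); split; [|split].
- move=> j; split; first exact: spinor_of_homog.
  by apply/eqP; rewrite -KP vbasis_mem // mem_nth // size_tuple.
- move=> c; rewrite -spinor_of_sum => E.
  have E0 := spinor_of_inj n _ _ (etrans E (esym (spinor_of0 n))).
  have /freeP := basis_free (vbasisP K); apply.
  exact E0.
move=> v [hv Dv]; have vK := hspinor_ofK n v hv.
exists (fun j => coord (vbasis K) j (hspinor_of n v)).
have vin : hspinor_of n v \in K by rewrite KP vK; apply/eqP.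
rewrite -[LHS]vK; apply: etrans (spinor_of_sum n _ _ _ _).
exact: congr1 (coord_vbasis vin).
Qed.

(** * Dimension count *)

(** Two components, each with C(n + 2, 2) monomials of degree n in three variables. *)
Lemma dim_hspinor n : \dim {: hspinor n} = (n.+2 * n.+1)%N.
Proof.
rewrite dimvf (_ : dim _ = 2 * 'C(n + 2, n))%N; last by rewrite /dim /= card_ord.
by rewrite -bin_sub ?leq_addr // addKn mulnC (bin_ffact _ 2) addn2 ffactnS ffactn1.
Qed.

Lemma dunkl_const k j (p : Pol) : p \is 0.-homog -> dunkl k j p = 0.
Proof.
move=> hp; rewrite [p]mpolyE linear_sum big_seq big1 // => m m_in.
have /eqP := dhomog_mf hp m_in; rewrite mdeg_eq0 => /eqP ->.
by rewrite linearZ /= dunklX mnm0E RtoC_dunkl_num0 scale0r scaler0.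
Qed.

Lemma dim_lker_hdirac k n :
  lt_max_t n k \/ sum_t_le n k -> \dim (lker (linfun (hdirac k n))) = (2 * n.+1)%N.
Proof.
move=> hk; have := limg_ker_dim (linfun (hdirac k n)) fullv.
rewrite capfv dim_hspinor; case: n hk => [|n] hk.
  (* Constants are killed, so the kernel is the whole space, of dimension 2. *)
  suff -> : linfun (hdirac k 0) = 0 by rewrite lim0g dimv0 addn0.
  apply/lfunP => u; rewrite (lfunE (hdirac k 0)) zero_lfunE; apply: spinor_of_inj.
  apply: etrans (hdiracE k 0 u) _; apply: etrans _ (esym (spinor_of0 0)).
  apply/matrixP => a b; rewrite dirac_dunklE mxE big1 // => j _; rewrite big1 // => c _.
  by rewrite dunkl_const ?scaler0 //; exact: spinor_of_homog.
(* In degree n + 1 the hypothesis is exactly what surjectivity onto degree n requires. *)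
suff -> : limg (linfun (hdirac k n.+1)) = fullv by rewrite dim_hspinor; nia.
apply/vspaceP => w; rewrite memvf.
have [v hv Dv] := dirac_image_homog k n _ hk (spinor_of_homog n w).
have -> : w = linfun (hdirac k n.+1) (hspinor_of n.+1 v); last exact: memv_img (memvf _).
rewrite (lfunE (hdirac k n.+1)); apply: spinor_of_inj.
apply: etrans _ (esym (hdiracE k n.+1 _)); rewrite -Dv.
exact: congr1 (esym (hspinor_ofK n.+1 v hv)).
Qed.

Theorem theorem1p2 (k : 'I_3 -> R) (n : nat) :
  lt_max_t n k \/ sum_t_le n k ->
  has_dimC (monogenic k n) (2 * n.+1).
Proof. by move=> hk; apply/monogenic_dim/dim_lker_hdirac. Qed.
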